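(* Suppose that $\mu_0^N\to\mu_0$ as $N\to\infty$ (with probability one), where $\mu_0\in\mathsf{S}$, and that the state transition matrix $P_\zeta$ is continuous as a function of $\zeta\in\mathbb{R}$. Suppose that for each $N$ the input is obtained by state feedback $\zeta_t^N=\phi_t(\mu_0^N,\dots,\mu_t^N)$, $t\ge0$, where $\phi_t\colon\mathsf{S}^{t+1}\to\mathbb{R}$ is continuous for each $t$ and does not depend on $N$. Then for each $t$, $$\lim_{N\to\infty}\mu_t^N=\mu_t,\qquad\text{with probability one},$$ where $\mu_t$ is the probability measure $$\mu_t(x_t)=\sum_{x_0,\dots,x_{t-1}\in\mathsf{X}}\mu_0(x_0)P_{\zeta_0}(x_0,x_1)P_{\zeta_1}(x_1,x_2)\cdots P_{\zeta_{t-1}}(x_{t-1},x_t),\qquad x_t\in\mathsf{X},$$ in which $\zeta_t=\phi_t(\mu_0,\dots,\mu_t)$, $t\ge0$.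
   Context: $\mathsf{X}=\{x^1,\dots,x^d\}$ is a finite set, $\mathsf{S}$ is the $d$-dimensional simplex of probability measures on $\mathsf{X}$ (row vectors), and $\{P_\zeta:\zeta\in\mathbb{R}\}$ is a family of transition (stochastic) matrices on $\mathsf{X}$. There are $N$ loads; $X_t^i\in\mathsf{X}$ is the state of the $i$th load at time $t$ (dependence on $N$ suppressed), and the empirical distribution is $$\mu_t^N(x)=\frac1N\sum_{i=1}^N\mathbb{I}\{X_t^i=x\},\qquad x\in\mathsf{X}.$$ All loads receive the common scalar input $\zeta_t^N$ and evolve with transition probability $\Pr\{X^i_{t+1}=x^+\mid X^i_t=x^-,\ \zeta^N_t=\zeta\}=P_\zeta(x^-,x^+)$, independently across loads in the following sense: writing $\pi_t^i\in\mathsf{S}$ for the degenerate distribution (row vector) with mass at $X_t^i$, one has $\pi_{t+1}^i=\pi_t^iG_{t+1}^i$ with $G_{t+1}^i=\mathcal{G}(\zeta_t^N,\xi_{t+1}^i)$, where $\{\xi_t^i:t\ge1,i\ge1\}$ are i.i.d. and independent of the initial states, $\mathcal{G}(\zeta,\xi)$ is a $d\times d$ matrix with entries in $\{0,1\}$ and exactly one $1$ in each row, and $\mathsf{E}[\mathcal{G}(\zeta,\xi_t^i)]=P_\zeta$ for each $\zeta$. *)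

(* Defs.v *)
From HB Require Import structures.
From mathcomp Require Export all_boot all_order all_algebra.
From mathcomp Require Export all_classical all_reals all_analysis.

Set Implicit Arguments.
Unset Strict Implicit.
Unset Printing Implicit Defensive.
Import Order.TTheory GRing.Theory Num.Theory.
Import numFieldNormedType.Exports.
Local Open Scope classical_set_scope.
Local Open Scope ring_scope.

(* The finite state space with d elements is 'I_d; measures on it are row
   vectors. *)

Definition simplex {R : realType} {d : nat} : set 'rV[R]_d :=
  [set v | (forall x, 0 <= v 0 x) /\ \sum_x v 0 x = 1].

(* For m = d these are the transition matrices; for general m this is the
   m-fold power of the simplex, a tuple of measures being stored as the rows
   of a matrix (whose topology is the product one). *)
Definition stochastic {R : realType} {m d : nat} : set 'M[R]_(m, d) :=
  [set M | forall i, simplex (row i M)].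

Definition selection_matrix {R : realType} (d : nat) (M : 'M[R]_d) : Prop :=
  (forall x y, M x y = 0 \/ M x y = 1) /\ (forall x, exists! y, M x y = 1).

Definition point_mass {R : realType} (d : nat) (x : 'I_d) : 'rV[R]_d :=
  delta_mx 0 x.

Definition empirical {R : realType} (d N : nat) (x : 'I_N -> 'I_d) : 'rV[R]_d :=
  \row_y (N%:R^-1 * \sum_(i < N) (x i == y)%:R).

Definition history {R : realType} (d : nat) (mu : nat -> 'rV[R]_d) (t : nat) :
    'M[R]_(t.+1, d) :=
  \matrix_(s < t.+1) mu s.

(* The sum is over paths (x_0, ..., x_t) with x_t = y prescribed. *)
Definition marginal {R : realType} (d : nat) (mu0 : 'rV[R]_d)
    (P : R -> 'M[R]_d) (zeta : nat -> R) (t : nat) : 'rV[R]_d :=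
  \row_y \sum_(x : {ffun 'I_t.+1 -> 'I_d} | x ord_max == y)
    mu0 0 (x ord0) *
    \prod_(s < t) P (zeta s) (x (inord s)) (x (inord s.+1)).

Section independence.
Context {dO : measure_display} {Omega : measurableType dO} {R : realType}.
Variable Pr : probability Omega R.

(* The sigma-algebra generated by a family of maps to possibly bare types, the
   target of each map carrying the set system M. *)
Definition sigma_family {I E : Type} (M : set (set E)) (Y : I -> Omega -> E) :
    set (set Omega) :=
  <<s \bigcup_i preimage_set_system setT (Y i) M >>.

Definition independent_systems (F G : set (set Omega)) : Prop :=
  forall A B, F A -> G B -> Pr (A `&` B) = (Pr A * Pr B)%E.

Definition mutually_independent {dE : measure_display} {E : measurableType dE}
    {I : choiceType} (Y : I -> {RV Pr >-> E}) : Prop :=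
  forall (J : seq I) (A : I -> set E), uniq J ->
    (forall i, measurable (A i)) ->
    Pr (\bigcap_(i in [set` J]) (Y i @^-1` A i)) =
    (\prod_(i <- J) Pr (Y i @^-1` A i))%E.

Definition identically_distributed {dE : measure_display}
    {E : measurableType dE} {I : Type} (Y : I -> {RV Pr >-> E}) : Prop :=
  forall i j (A : set E), measurable A ->
    distribution Pr (Y i) A = distribution Pr (Y j) A.

End independence.

(* Main.v *)
Require Import Defs.
From mathcomp Require Import ring lra.
Import Order.TTheory GRing.Theory Num.Theory.
Import numFieldNormedType.Exports.
Local Open Scope classical_set_scope.
Local Open Scope ring_scope.

(* Fix N and t.  Since the input is a function of the past states, prescribing
   the path of all N loads prescribes the inputs, so the event that a given path
   occurs is an intersection of events on the initial states and on the
   individual noises, and its probability is an explicit product.  Hence, given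
   the past, the next states are independent with laws P_zeta(X_t^i, .), and a
   Chernoff bound gives
     Pr(|mu_{t+1}^N(y) - (mu_t^N P_{zeta_t^N})(y)| >= eps) <= 2 exp(-N eps^2/8).
   By Borel-Cantelli this deviation tends to 0 almost surely, and the limit
   follows by induction on t from the continuity of phi and of P. *)

(** * Chernoff bound for product weights on a finite set *)

(** Apply [1 + u <= expR u] at [u = 2x^2 - x] and invert; what remains is
    [(1 + x)(1 + u) = 1 + x^2 (1 + 2x) >= 1]. *)
Lemma expR_le1Dx {R : realType} (x : R) :
  - 2^-1 <= x -> expR (x - 2 * x ^+ 2) <= 1 + x.
Proof.
move=> hx.
have hge := expR_ge1Dx (2 * x ^+ 2 - x).
have -> : x - 2 * x ^+ 2 = - (2 * x ^+ 2 - x) by ring.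
rewrite expRN; set y := expR _ in hge *.
have y0 : 0 < y by exact: expR_gt0.
rewrite -[_^-1]mul1r ler_pdivrMr//.
have x1 : 0 <= 1 + x by lra.
apply: (le_trans _ (ler_wpM2l x1 hge)).
have -> : (1 + x) * (1 + (2 * x ^+ 2 - x)) = 1 + x ^+ 2 * (1 + 2 * x) by ring.
rewrite lerDl mulr_ge0 ?sqr_ge0//; lra.
Qed.

(* The weights make the coordinates [x i] independent with laws [Q i]; the
   product of the [1 + lambda * D_i] has mean one, which is the Chernoff
   argument with [1 + lambda D] in place of [exp (lambda D)]. *)
Lemma product_tail {R : realType} (I T : finType) (Q : I -> T -> R)
    (D : I -> T -> R) (eps : R) (B : pred {ffun I -> T}) :
  0 < eps -> eps <= 1 ->
  (forall i x, 0 <= Q i x) -> (forall i, \sum_x Q i x = 1) ->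
  (forall i x, `|D i x| <= 1) -> (forall i, \sum_x Q i x * D i x = 0) ->
  (forall x, B x -> #|I|%:R * eps <= \sum_i D i (x i)) ->
  \sum_(x | B x) \prod_i Q i (x i) <= expR (- (eps ^+ 2 / 8)) ^+ #|I|.
Proof.
move=> e0 e1 Q0 Q1 D1 QD HB.
(* The choice [l = eps / 4] maximizes [l * eps - 2 * l^2], with maximum [c]; since [eps <= 1], it
   also keeps [l * D] above [-1/2]. *)
set c := eps ^+ 2 / 8; set l := eps / 4.
have one : \sum_(x : {ffun I -> T}) \prod_i (Q i (x i) * (1 + l * D i (x i))) = 1.
  rewrite -(bigA_distr_bigA (fun i x => Q i x * (1 + l * D i x))).
  apply: big1 => i _.
  under eq_bigr => x _ do rewrite mulrDr mulr1 mulrCA.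
  by rewrite big_split/= -mulr_sumr Q1 QD mulr0 addr0.
have l0 : 0 < l by rewrite /l; lra.
have l1 : l <= 2^-1 by rewrite /l; lra.
have lD i x : - 2^-1 <= l * D i x.
  have := D1 i x; rewrite ler_norml => /andP[h _].
  have : l * -1 <= l * D i x by rewrite ler_wpM2l// ltW.
  lra.
(* Markov's inequality: the tilted product is nonnegative everywhere and at least [expR (#|I| * c)]
   on [B]. *)
rewrite -expRM_natl mulrN expRN -[leRHS]mul1r ler_pdivlMr ?expR_gt0//.
rewrite -[leRHS]one mulr_suml [leRHS](bigID B)/= ler_wpDr//.
  apply: sumr_ge0 => x _; apply: prodr_ge0 => i _.
  rewrite mulr_ge0//; have := lD i (x i); lra.
apply: ler_sum => x Bx; rewrite big_split/=.
apply: ler_wpM2l; first exact: prodr_ge0.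
apply: (@le_trans _ _ (expR (\sum_i (l * D i (x i) - 2 * (l * D i (x i)) ^+ 2)))).
  rewrite ler_expR.
  have h2 i : l * D i (x i) - 2 * l ^+ 2 <= l * D i (x i) - 2 * (l * D i (x i)) ^+ 2.
    rewrite lerD2l lerN2 exprMn ler_pM2l ?ltr0n//.
    rewrite -[leRHS]mulr1 ler_wpM2l ?sqr_ge0// -real_normK ?num_real//.
    by rewrite expr_le1 ?normr_ge0.
  apply: (le_trans _ (ler_sum _ (fun i _ => h2 i))).
  rewrite big_split/= sumr_const -mulr_sumr.
  have := ler_wpM2l (ltW l0) (HB x Bx).
  rewrite cardT -cardE -mulr_natl /c /l.
  lra.
by rewrite expR_sum ler_prod// => i _; rewrite expR_ge0/= expR_le1Dx.
Qed.

(** * Finite partitions, Borel-Cantelli, generated sigma-algebras *)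

Lemma probability_fibers {d} {T : measurableType d} {R : realType}
    (Pr : probability T R) (K : finType) (H : T -> K) (B : pred K) :
  (forall k, measurable (H @^-1` [set k])) ->
  Pr (H @^-1` [set` B]) = (\sum_(k | B k) Pr (H @^-1` [set k]))%E.
Proof.
move=> mH; rewrite -big_filter.
have -> : [set` B] = [set` [seq k <- index_enum K | B k]].
  by apply/seteqP; split => k /=; rewrite mem_filter mem_index_enum andbT.
have := filter_uniq B (index_enum_uniq K).
elim: [seq k <- _ | B k] => [_|k s IH /= /andP[ks us]].
  by rewrite big_nil set_nil preimage_set0 measure0.
have ms : measurable (H @^-1` [set` s]).
  have -> : H @^-1` [set` s] = \bigcup_(k in [set` s]) H @^-1` [set k].
    by apply/seteqP; split => [w /= ?|w [k' /= ? ->//]]; exists (H w).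
  by apply: fin_bigcup_measurable => //; exact: finite_seq.
rewrite big_cons -IH// -measureU//.
  congr (Pr _); apply/seteqP; split => w /=; rewrite in_cons.
    by case/orP => [/eqP|]; [left|right].
  by case=> [->|->]; rewrite ?eqxx ?orbT.
by rewrite -subset0 => w [/= -> /=]; rewrite (negPf ks).
Qed.

(** Borel-Cantelli: the geometric bound is summable, so the limsup set is null, and a point outside
    it lies in only finitely many [F n]. *)
Lemma ae_near_notin {d} {T : measurableType d} {R : realType}
    (mu : {measure set T -> \bar R}) (F : (set T)^nat) (a q : R) :
  0 <= q < 1 ->
  (forall n, measurable (F n)) -> (forall n, mu (F n) <= (a * q ^+ n)%:E)%E ->
  {ae mu, forall w, \forall n \near \oo, ~ F n w}.
Proof.
move=> /andP[q0 q1] mF bF.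
have S : (\sum_(n <oo) mu (F n) < +oo)%E.
  apply: (@le_lt_trans _ _ (\sum_(n <oo) (geometric a q n)%:E)%E).
    by apply: lee_nneseries => // n _; exact: bF.
  have c := @cvg_geometric_series R a q.
  rewrite ger0_norm// in c; have {}c := c q1.
  have -> : (\sum_(n <oo) (geometric a q n)%:E)%E = (a * (1 - q)^-1)%:E.
    apply/cvg_lim => //.
    under eq_fun do rewrite sumEFin.
    by apply: cvg_EFin; [exact: nearW|exact: c].
  by rewrite ltry.
have z := lim_sup_set_cvg0 mF S.
exists (lim_sup_set F); split => //.
  by apply: bigcapT_measurable => n; exact: bigcup_measurable.
move=> w /= nw n _; apply: contrapT => h; apply: nw.
exists n => // m /= nm Fm; apply: h; by exists m.
Qed.

(** Puts finite cylinder events into the sigma-algebras between which independence is assumed. *)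
Lemma sigma_family_bigcap {dO} {Omega : measurableType dO} {I : choiceType}
    {E : Type} (M : set (set E)) (Y : I -> Omega -> E) (J : set I)
    (A : I -> set E) :
  finite_set J -> (forall i, J i -> M (A i)) ->
  sigma_family M Y (\bigcap_(i in J) (Y i @^-1` A i)).
Proof.
move=> fJ MA.
apply: (@fin_bigcap_measurable _ (g_sigma_algebraType
  (\bigcup_i preimage_set_system setT (Y i) M))) => // i Ji.
apply: sub_sigma_algebra; exists i => //; exists (A i); first exact: MA.
by rewrite setTI.
Qed.

(** * Entries of stochastic matrices *)

Lemma stochastic_ge0 {R : realType} {m d : nat} (M : 'M[R]_(m, d)) i x :
  stochastic M -> 0 <= M i x.
Proof. by move=> /(_ i)[/(_ x)]; rewrite mxE. Qed.

Lemma stochastic_sum {R : realType} {m d : nat} (M : 'M[R]_(m, d)) i :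
  stochastic M -> \sum_x M i x = 1.
Proof.
by move=> /(_ i)[_ <-]; apply: eq_bigr => x _; rewrite mxE.
Qed.

Lemma stochastic_le1 {R : realType} {m d : nat} (M : 'M[R]_(m, d)) i x :
  stochastic M -> M i x <= 1.
Proof.
move=> sM; rewrite -(stochastic_sum _ i sM) (bigD1 x)//= lerDl.
by apply: sumr_ge0 => y _; exact: stochastic_ge0.
Qed.

(** * Law of the paths of a population of fixed size *)

Section population.
Context {R : realType} {d : nat} {dO : measure_display}
  {Omega : measurableType dO} {Pr : probability Omega R}
  {dE : measure_display} {E : measurableType dE}.
Context (P : R -> 'M[R]_d) (G : R -> E -> 'M[R]_d)
  (xi : nat * nat -> {RV Pr >-> E}) (N : nat)
  (X : nat -> 'I_N -> Omega -> 'I_d) (zeta : nat -> Omega -> R)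
  (phi : forall t : nat, 'M[R]_(t.+1, d) -> R).
Hypothesis P_stochastic : forall z, stochastic (P z).
Hypothesis G_selection : forall z e, selection_matrix (G z e).
Hypothesis G_measurable :
  forall z x y, measurable_fun [set: E] (fun e => G z e x y).
Hypothesis G_mean : forall z k x y,
  ('E_Pr[fun w => G z (xi k w) x y] = (P z x y)%:E)%E.
Hypothesis xi_indep : mutually_independent xi.
Hypothesis X0_measurable : forall i x, measurable (X 0%N i @^-1` [set x]).
Hypothesis X0_xi_indep : independent_systems Pr
  (sigma_family [set: set 'I_d] (X 0%N))
  (sigma_family measurable (fun k => xi k : Omega -> E)).
Hypothesis X_step : forall t (i : 'I_N) w,
  point_mass (X t.+1 i w) =
  point_mass (X t i w) *m G (zeta t w) (xi (t, i : nat) w) :> 'rV[R]_d.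
Hypothesis zeta_feedback : forall t w,
  zeta t w = phi t (history (fun s => empirical (fun i => X s i w)) t).

Implicit Type h : nat -> nat -> 'I_d.

(** Paths are indexed by naturals so as to share the (time, load) index of [xi]; only loads below
    [N] matter. *)
Definition path_input h (t : nat) : R :=
  phi t (history (fun s => empirical (fun i : 'I_N => h s i)) t).

Definition path_event (t : nat) h : set Omega :=
  [set w | forall s i, (s <= t)%N -> X s i w = h s i].

Definition transition_set (z : R) (x y : 'I_d) : set E :=
  [set e | G z e x y = 1].

Definition path_noise h (k : nat * nat) : set E :=
  transition_set (path_input h k.1) (h k.1 k.2) (h k.1.+1 k.2).

Definition noise_grid (t : nat) : seq (nat * nat) :=
  [seq (s, i) | s <- iota 0 t, i <- iota 0 N].

Lemma path_inputE t h w : path_event t h w -> zeta t w = path_input h t.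
Proof.
move=> hw; rewrite zeta_feedback /path_input; congr phi.
apply/matrixP => s x; rewrite !mxE; congr (_ * _); apply: eq_bigr => i _.
by rewrite hw// -ltnS.
Qed.

(** A point mass extracts the row of [G] at the current state; by [X_step] this row is the point
    mass at the next state. *)
Lemma X_transition t i w y :
  X t.+1 i w = y <->
  transition_set (zeta t w) (X t i w) y (xi (t, i : nat) w).
Proof.
have /matrixP/(_ 0 y) := X_step t i w.
rewrite /point_mass -rowE !mxE eqxx/= /transition_set/= => <-.
split=> [->|]; first by rewrite eqxx.
by case: eqVneq => //= _ /eqP; rewrite eq_sym oner_eq0.
Qed.

Lemma mem_noise_grid t s i :
  ((s, i) \in noise_grid t) = (s < t)%N && (i < N)%N.
Proof.
apply/allpairsP/andP => [[[s' i'] /= [+ + [-> ->]]]|[st iN]].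
  by rewrite !mem_iota.
by exists (s, i); rewrite /= !mem_iota.
Qed.

Lemma noise_grid_uniq t : uniq (noise_grid t).
Proof. by apply: allpairs_uniq; rewrite ?iota_uniq// => -[? ?] [? ?]. Qed.

(** This removes the feedback: along a prescribed path the random input becomes the constant
    [path_input], leaving fixed conditions on the initial states and on each noise separately. *)
Lemma path_eventE t h : path_event t h =
  (\bigcap_(i in [set: 'I_N]) (X 0%N i @^-1` [set h 0%N i])) `&`
  (\bigcap_(k in [set` noise_grid t]) (xi k @^-1` path_noise h k)).
Proof.
apply/seteqP; split => [w hw|w [h0 hs] s].
  split=> [i _|[s i]]; first by rewrite /= hw.
  rewrite /= mem_noise_grid => /andP[st iN].
  have hws : path_event s h w.
    by move=> s' j s's; apply: hw; rewrite (leq_trans s's)// ltnW.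
  have := hw s.+1 (Ordinal iN) st; rewrite X_transition (path_inputE _ _ _ hws).
  by rewrite (hws s (Ordinal iN) (leqnn s)).
(* The induction must carry all loads and all earlier times, since the input at [s] depends on all
   of them. *)
suff H : (s <= t)%N -> path_event s h w by move=> i st; exact: (H st s i).
elim: s => [_|s IH st].
  by move=> s i; rewrite leqn0 => /eqP ->; exact: h0.
have hws := IH (ltnW st).
move=> s' i; rewrite leq_eqVlt => /orP[/eqP ->|]; last by rewrite ltnS; exact: hws.
rewrite X_transition (path_inputE _ _ _ hws) (hws s i (leqnn s)).
by apply: (hs (s, i : nat)); rewrite /= mem_noise_grid st ltn_ord.
Qed.

Lemma measurable_transition_set z x y : measurable (transition_set z x y).
Proof.
rewrite -[X in measurable X]setTI.
exact: (G_measurable z x y measurableT [set 1]).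
Qed.

Lemma measurable_noise k z x y : measurable (xi k @^-1` transition_set z x y).
Proof.
rewrite -[X in measurable X]setTI.
exact: (measurable_funPT (xi k) measurableT _ (measurable_transition_set z x y)).
Qed.

Lemma measurable_path_event t h : measurable (path_event t h).
Proof.
rewrite path_eventE; apply: measurableI.
  by apply: fin_bigcap_measurable => [|i _]; [exact: finite_finset|].
by apply: fin_bigcap_measurable => [|k _]; [exact: finite_seq|exact: measurable_noise].
Qed.

(** An entry of a selection matrix is the indicator of its being 1, so its mean is a probability. *)
Lemma transition_prob k z x y :
  Pr (xi k @^-1` transition_set z x y) = (P z x y)%:E.
Proof.
rewrite -(G_mean z k) -expectation_indic; last exact: measurable_noise.
congr expectation; apply/funext => w; rewrite indicE.
have [G01 _] := G_selection z (xi k w).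
have [Gk|Gk] := G01 x y; rewrite Gk.
  by rewrite memNset// /transition_set /= Gk => /eqP; rewrite eq_sym oner_eq0.
by rewrite mem_set.
Qed.

Lemma path_prob t h : Pr (path_event t h) =
  (Pr (\bigcap_(i in [set: 'I_N]) (X 0%N i @^-1` [set h 0%N i])) *
   \prod_(k <- noise_grid t)
     (P (path_input h k.1) (h k.1 k.2) (h k.1.+1 k.2))%:E)%E.
Proof.
rewrite path_eventE X0_xi_indep.
- rewrite xi_indep ?noise_grid_uniq//; last first.
    by move=> k; exact: measurable_transition_set.
  by congr (_ * _)%E; apply: eq_bigr => k _; exact: transition_prob.
- by apply: sigma_family_bigcap => //; exact: finite_finset.
- apply: sigma_family_bigcap; first exact: finite_seq.
  by move=> k _; exact: measurable_transition_set.
Qed.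

(** The grid gains one row of noises, those of time [t]. This is conditional independence of the
    next states given the past, in product form so that null pasts need no care. *)
Lemma path_probS t h : Pr (path_event t.+1 h) =
  (Pr (path_event t h) *
   (\prod_(i < N) P (path_input h t) (h t i) (h t.+1 i))%:E)%E.
Proof.
rewrite !path_prob -muleA; congr (_ * _)%E.
rewrite /noise_grid.
have -> : iota 0 t.+1 = iota 0 t ++ [:: t] by rewrite -addn1 iotaD.
rewrite !big_allpairs big_cat/= big_seq1.
congr (_ * _)%E; rewrite -[X in iota 0 X]subn0 -/(index_iota 0 N).
rewrite big_mkord.
by elim/big_ind2 : _ => // x1 y1 x2 y2 -> ->; rewrite EFinM.
Qed.

(** [N] times the gap between the new empirical measure at [y] and its one-step prediction; see
    [empirical_step]. *)
Definition deviation (t : nat) (y : 'I_d) (w : Omega) : R :=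
  \sum_(i < N) ((X t.+1 i w == y)%:R - P (zeta t w) (X t i w) y).

(** With [sg] equal to 1 and to -1, a one-sided bound covers both tails. *)
Definition deviation_event (t : nat) (y : 'I_d) (sg eps : R) : set Omega :=
  [set w | N%:R * eps <= sg * deviation t y w].

(** * Exponential tail of the one-step deviation *)

Section deviation_tail.
Variable t : nat.
Hypothesis N_gt0 : (0 < N)%N.

Local Notation state := {ffun 'I_N -> 'I_d}.
Local Notation past := {ffun 'I_t.+1 -> state}.

(** Pasts form a finite type, over which probabilities can be summed; [index] and [inord] turn them
    back into paths on naturals, with junk values out of range. *)
Let index (i : nat) : 'I_N := insubd (Ordinal N_gt0) i.

Let pasth (p : past) : nat -> nat -> 'I_d :=
  fun s i => p (inord s) (index i).

Let fullh (k : past * state) : nat -> nat -> 'I_d :=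
  fun s i => if (s <= t)%N then pasth k.1 s i else k.2 (index i).

Let pastX (w : Omega) : past :=
  [ffun s : 'I_t.+1 => [ffun i : 'I_N => X s i w]].
Let fullX (w : Omega) : past * state := 
  (pastX w, [ffun i : 'I_N => X t.+1 i w]).

Let indexK (i : 'I_N) : index i = i.
Proof. by rewrite /index valKd. Qed.

Let pastX_fiber p : pastX @^-1` [set p] = path_event t (pasth p).
Proof.
apply/seteqP; split => w /=.
  by move=> <- s i st; rewrite /pasth !ffunE inordK ?ltnS// indexK.
move=> hw; apply/ffunP => s; apply/ffunP => i; rewrite !ffunE (hw _ _ (leq_ord s)).
by rewrite /pasth indexK inord_val.
Qed.

Let fullX_fiber k : fullX @^-1` [set k] = path_event t.+1 (fullh k).
Proof.
apply/seteqP; split => w /=.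
  move=> <- s i st1; rewrite /fullh /=; case: leqP => st.
    by rewrite /pasth !ffunE inordK ?ltnS// indexK.
  have -> : s = t.+1 by apply/eqP; rewrite eqn_leq st1 st.
  by rewrite !ffunE indexK.
case: k => p x hw; congr pair.
  apply/ffunP => s; apply/ffunP => i; rewrite !ffunE (hw _ _ (leqW (leq_ord s))).
  by rewrite /fullh leq_ord /pasth indexK inord_val.
by apply/ffunP => i; rewrite ffunE (hw _ _ (leqnn _)) /fullh ltnn indexK.
Qed.

Let fullh_event k : path_event t (fullh k) = path_event t (pasth k.1).
Proof.
by apply/seteqP; split => w hw s i st; rewrite (hw _ _ st) /fullh st.
Qed.

Let fullh_input k : path_input (fullh k) t = path_input (pasth k.1) t.
Proof.
rewrite /path_input; congr phi; apply/matrixP => s x; rewrite !mxE.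
by congr (_ * _); apply: eq_bigr => i _; rewrite /fullh leq_ord.
Qed.

Let bad (y : 'I_d) (sg eps : R) (k : past * state) : bool :=
  N%:R * eps <= \sum_(i < N) (sg * ((k.2 i == y)%:R -
    P (path_input (pasth k.1) t) (pasth k.1 t i) y)).

(** The past determines the input at [t], so the event depends on [w] only through the finitely
    valued [fullX]. *)
Let deviation_preimage y sg eps :
  deviation_event t y sg eps = fullX @^-1` [set` bad y sg eps].
Proof.
apply/seteqP; split => w /=; rewrite /deviation_event /bad /deviation /= mulr_sumr
    (path_inputE t (pasth (pastX w)) w) -?pastX_fiber//=;
  move=> /le_trans; apply; rewrite le_eqVlt; apply/orP; left; apply/eqP;
  apply: eq_bigr => i _;
  by rewrite /pasth !ffunE /= indexK inordK.
Qed.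

Lemma measurable_deviation_event y sg eps :
  measurable (deviation_event t y sg eps).
Proof.
rewrite deviation_preimage.
have -> : fullX @^-1` [set` bad y sg eps] =
    \bigcup_(k in [set` bad y sg eps]) fullX @^-1` [set k].
  by apply/seteqP; split => [w /= ?|w [k' /= ? ->//]]; exists (fullX w).
apply: fin_bigcup_measurable => [|k _]; first exact: finite_finset.
by rewrite fullX_fiber; exact: measurable_path_event.
Qed.

(* Condition on the past: given it, the next states are independent. *)
Lemma deviation_tail y sg eps : `|sg| <= 1 -> 0 < eps -> eps <= 1 ->
  (Pr (deviation_event t y sg eps) <=
   (expR (- (eps ^+ 2 / 8)) ^+ N)%:E)%E.
Proof.
move=> sg1 e0 e1; rewrite deviation_preimage probability_fibers; last first.
  by move=> k; rewrite fullX_fiber; exact: measurable_path_event.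
pose z p := path_input (pasth p) t.
pose q (p : past) (i : 'I_N) x := P (z p) (pasth p t i) x.
have prob k : Pr (fullX @^-1` [set k]) =
    (Pr (path_event t (pasth k.1)) * (\prod_(i < N) q k.1 i (k.2 i))%:E)%E.
  rewrite fullX_fiber path_probS fullh_event fullh_input.
  congr (_ * _%:E)%E; apply: eq_bigr => i _.
  by rewrite /q /fullh leqnn ltnn indexK.
under eq_bigr => k _ do rewrite prob.
rewrite -(pair_big_dep xpredT (fun p x => bad y sg eps (p, x))
  (fun p x => Pr (path_event t (pasth p)) * (\prod_(i < N) q p i (x i))%:E)%E)/=.
(* The pasts have total mass 1, so it suffices to bound the inner sum for each past by the same
   constant. *)
have total : (\sum_p Pr (path_event t (pasth p)) = 1)%E.
  rewrite -[RHS](@probability_setT _ _ _ Pr).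
  have -> : [set: Omega] = pastX @^-1` [set` xpredT] by apply/seteqP.
  rewrite probability_fibers => [|p]; first by under eq_bigr do rewrite -pastX_fiber.
  by rewrite pastX_fiber; exact: measurable_path_event.
rewrite -[leRHS]mul1e -total ge0_sume_distrl; last by move=> *; exact: measure_ge0.
apply: lee_sum => p _.
rewrite -ge0_sume_distrr; last first.
  by move=> x _; rewrite lee_fin; apply: prodr_ge0 => i _; exact: stochastic_ge0.
apply: lee_wpmul2l; first exact: measure_ge0.
rewrite sumEFin lee_fin -[X in _ ^+ X]card_ord.
apply: (product_tail _ _ (q p) (fun i x => sg * ((x == y)%:R - q p i y))) => //.
- by move=> i x; exact: stochastic_ge0.
- by move=> i; exact: stochastic_sum.
- move=> i x; rewrite normrM mulr_ile1//.
  have := stochastic_ge0 _ (pasth p t i) y (P_stochastic (z p)).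
  have := stochastic_le1 _ (pasth p t i) y (P_stochastic (z p)).
  rewrite -/(q p i y) => h1 h0.
  by rewrite ler_norml; case: (x == y); apply/andP; split; rewrite /=; lra.
- move=> i; under eq_bigr do rewrite mulrCA mulrBr.
  rewrite -mulr_sumr big_split/= sumrN -mulr_suml stochastic_sum// mul1r.
  rewrite (bigD1 y)//= eqxx mulr1 big1 ?addr0 ?subrr ?mulr0//.
  by move=> x /negPf ->; rewrite mulr0.
- by move=> x; rewrite card_ord.
Qed.

End deviation_tail.
End population.

(** * The limiting marginals and the simplex *)

Lemma marginal0 {R : realType} {d : nat} (mu0 : 'rV[R]_d) P zeta :
  marginal mu0 P zeta 0 = mu0.
Proof.
apply/rowP => y; rewrite mxE (big_pred1 [ffun=> y]) => [|x].
  by rewrite ffunE big_ord0 mulr1.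
apply/eqP/eqP => [<-|->]; last by rewrite ffunE.
by apply/ffunP => i; rewrite ffunE !ord1.
Qed.

(** A path ending at [y] is a shorter path with [y] appended: [ext] appends it and [res] drops the
    last state. *)
Lemma marginalS {R : realType} {d : nat} (mu0 : 'rV[R]_d) P zeta t :
  marginal mu0 P zeta t.+1 = marginal mu0 P zeta t *m P (zeta t).
Proof.
apply/rowP => y; rewrite !mxE.
pose ext (x : {ffun 'I_t.+1 -> 'I_d}) : {ffun 'I_t.+2 -> 'I_d} :=
  [ffun i => oapp x y (unlift ord_max i)].
pose res (x : {ffun 'I_t.+2 -> 'I_d}) : {ffun 'I_t.+1 -> 'I_d} :=
  [ffun i => x (lift ord_max i)].
have ext_max x : ext x ord_max = y by rewrite ffunE unlift_none.
have ext_lift x i : ext x (lift ord_max i) = x i by rewrite ffunE liftK.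
have inord_lift s : (s <= t)%N -> inord s = lift ord_max (inord s : 'I_t.+1).
  by move=> st; apply: ord_inj; rewrite lift_max !inordK// ltnS// leqW.
have ext_inord x s : (s <= t)%N -> ext x (inord s) = x (inord s).
  by move=> st; rewrite inord_lift.
rewrite (reindex_onto ext res) => [|x /eqP xy]; last first.
  apply/ffunP => i; rewrite ffunE.
  by case: unliftP => [j ->|->]//=; rewrite ffunE.
under [RHS]eq_bigr do rewrite mxE mulr_suml.
(* After the exchange, each shorter path meets only one intermediate state, its own endpoint. *)
rewrite (exchange_big_dep xpredT)//=; apply: eq_big => [x|x _].
  by rewrite ext_max eqxx; apply/eqP/ffunP => i; rewrite ffunE ext_lift.
rewrite (big_pred1 (x ord_max)) => [|z]; last by rewrite eq_sym.
rewrite big_ord_recr/= mulrA.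
have -> : ord0 = inord 0 :> 'I_t.+2 by apply: val_inj; rewrite /= inordK.
have -> : ord0 = inord 0 :> 'I_t.+1 by apply: val_inj; rewrite /= inordK.
rewrite (ext_inord _ 0)// (ext_inord _ t)//.
have -> : inord t.+1 = ord_max :> 'I_t.+2 by apply: val_inj; rewrite /= inordK.
have -> : inord t = ord_max :> 'I_t.+1 by apply: val_inj; rewrite /= inordK.
rewrite ext_max; congr (_ * _ * _); apply: eq_bigr => s _.
by rewrite !ext_inord// ltnW.
Qed.

Lemma simplex_mulmx {R : realType} {m d : nat} (v : 'rV[R]_m) (M : 'M[R]_(m, d)) :
  simplex v -> stochastic M -> simplex (v *m M).
Proof.
move=> [v0 v1] sM; split=> [y|].
  by rewrite mxE; apply: sumr_ge0 => x _; rewrite mulr_ge0// stochastic_ge0.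
under eq_bigr do rewrite mxE.
rewrite exchange_big -[RHS]v1; apply: eq_bigr => x _.
by rewrite -mulr_sumr stochastic_sum ?mulr1.
Qed.

Lemma simplex_marginal {R : realType} {d : nat} (mu0 : 'rV[R]_d) P zeta t :
  simplex mu0 -> (forall z, stochastic (P z)) ->
  simplex (marginal mu0 P zeta t).
Proof.
move=> s0 sP; elim: t => [|t IH]; first by rewrite marginal0.
by rewrite marginalS; exact: simplex_mulmx.
Qed.

Lemma simplex_empirical {R : realType} {d N : nat} (x : 'I_N -> 'I_d) :
  (0 < N)%N -> simplex (empirical x : 'rV[R]_d).
Proof.
move=> N0; split=> [y|].
  by rewrite mxE mulr_ge0// ?invr_ge0 ?sumr_ge0// => *; exact: ler0n.
under eq_bigr do rewrite mxE.
rewrite -mulr_sumr exchange_big/=.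
under eq_bigr => i _.
  rewrite (bigD1 (x i))//= eqxx big1 ?addr0 => [|y /negPf]; last first.
    by rewrite eq_sym => ->.
  over.
by rewrite sumr_const card_ord mulVf// pnatr_eq0 -lt0n.
Qed.

Lemma stochastic_history {R : realType} {d : nat} (mu : nat -> 'rV[R]_d) t :
  (forall s, simplex (mu s)) -> stochastic (history mu t).
Proof.
move=> smu s; rewrite (_ : row s _ = mu s)//.
by apply/rowP => x; rewrite !mxE.
Qed.

(** * Limits of matrices and relative continuity *)

Lemma cvg_mx_entries {R : numFieldType} {T : Type} {F : set_system T}
    {FF : Filter F} {m n : nat} (f : T -> 'M[R]_(m, n)) (M : 'M[R]_(m, n)) :
  (forall i j, f x i j @[x --> F] --> M i j) -> f x @[x --> F] --> M.
Proof.
move=> fM A [B MB BA].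
suff : F (fun x => forall i j, B i j (f x i j)).
  by move=> FB; apply: (@filterS _ F FF _ (f @^-1` A) _ FB) => x Bx; exact: BA.
by do 2![apply: filter_forall => ?]; exact: fM (MB _ _).
Qed.

Lemma cvg_coord {R : numFieldType} {T : Type} {F : set_system T}
    {FF : Filter F} {m n : nat} (f : T -> 'M[R]_(m, n)) (M : 'M[R]_(m, n)) i j :
  f x @[x --> F] --> M -> f x i j @[x --> F] --> M i j.
Proof.
move=> fM.
exact: (@cvg_comp _ _ _ f (fun A : 'M[R]_(m, n) => A i j) _ _ _ fM
  (@coord_continuous _ _ _ i j M)).
Qed.

Lemma cvg_mulmx {R : numFieldType} {T : Type} {F : set_system T}
    {FF : Filter F} {m n p : nat} (f : T -> 'M[R]_(m, n)) (g : T -> 'M[R]_(n, p))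
    (A : 'M[R]_(m, n)) (B : 'M[R]_(n, p)) :
  f x @[x --> F] --> A -> g x @[x --> F] --> B ->
  f x *m g x @[x --> F] --> A *m B.
Proof.
move=> fA gB; apply: cvg_mx_entries => i j.
rewrite mxE; under eq_fun do rewrite mxE.
apply: (cvg_big add_continuous) => k _.
by apply: cvgM; exact: cvg_coord.
Qed.

(** Needed for [phi], whose continuity is given only on tuples of measures: the sequence must
    eventually stay in [A]. *)
Lemma within_continuous_cvg {U V : topologicalType} (A : set U) (f : U -> V)
    (T : Type) (F : set_system T) {FF : Filter F} (g : T -> U) (x : U) :
  {within A, continuous f} -> A x -> (\forall n \near F, A (g n)) ->
  g n @[n --> F] --> x -> f (g n) @[n --> F] --> f x.
Proof.
move=> /subspace_continuousP cf Ax Ag gx; apply: cvg_comp (cf x Ax).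
by move=> B /= wB; apply: filterS2 Ag (gx _ wB) => n /= ?; apply.
Qed.

(** * The law of large numbers under feedback *)

(** Grouping the loads by state turns the predicted measure at [y] into the average of
    [M (x i) y]. *)
Lemma empirical_step {R : realType} {d N : nat} (M : 'M[R]_d)
    (x x' : 'I_N -> 'I_d) y :
  empirical x' 0 y = (empirical x *m M) 0 y +
    N%:R^-1 * \sum_(i < N) ((x' i == y)%:R - M (x i) y).
Proof.
rewrite !mxE big_split/= sumrN mulrBr addrC -[LHS]addr0 -addrA; congr (_ + _).
apply/esym/eqP; rewrite addrC subr_eq0; apply/eqP.
under eq_bigr do rewrite mxE -mulrA mulr_suml.
rewrite -mulr_sumr exchange_big/=; congr (_ * _); apply: eq_bigr => i _.
rewrite (bigD1 (x i))//= eqxx mul1r big1 ?addr0// => z.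
by rewrite eq_sym => /negPf ->; rewrite mul0r.
Qed.

(* Loads and noise times are numbered from 0: xi (t, i) is the noise driving
   the transition of load i from time t to time t + 1. *)
Theorem mainTheorem5 (R : realType) (d : nat)
  (dO : measure_display) (Omega : measurableType dO) (Pr : probability Omega R)
  (dE : measure_display) (E : measurableType dE)
  (P : R -> 'M[R]_d)
  (G : R -> E -> 'M[R]_d)
  (xi : nat * nat -> {RV Pr >-> E})
  (X : forall N : nat, nat -> 'I_N -> Omega -> 'I_d)
  (zeta : nat -> nat -> Omega -> R)
  (phi : forall t : nat, 'M[R]_(t.+1, d) -> R)
  (mu0 : 'rV[R]_d) (zetabar : nat -> R)
  (muN := fun (N t : nat) (w : Omega) =>
            empirical (fun i => X N t i w) : 'rV[R]_d)
  (mu := marginal mu0 P zetabar)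
  (* the controlled transition matrices and their realization by G *)
  (P_stochastic : forall z, stochastic (P z))
  (G_selection : forall z e, selection_matrix (G z e))
  (G_measurable : forall z x y, measurable_fun [set: E] (fun e => G z e x y))
  (G_mean : forall z k x y,
     ('E_Pr[fun w => G z (xi k w) x y] = (P z x y)%:E)%E)
  (* the noise *)
  (xi_indep : mutually_independent xi)
  (xi_ident : identically_distributed xi)
  (* the initial states *)
  (X0_measurable : forall N i x, measurable (X N 0%N i @^-1` [set x]))
  (X0_xi_indep : forall N, independent_systems Pr
     (sigma_family [set: set 'I_d] (X N 0%N))
     (sigma_family measurable (fun k => xi k : Omega -> E)))
  (* the dynamics *)
  (X_step : forall N t (i : 'I_N) w,
     point_mass (X N t.+1 i w) =
     point_mass (X N t i w) *m G (zeta N t w) (xi (t, i : nat) w))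
  (* the hypotheses of the theorem *)
  (mu0_simplex : simplex mu0)
  (mu0_cvg : {ae Pr, forall w, muN N 0%N w @[N --> \oo] --> mu0})
  (P_continuous : continuous P)
  (phi_continuous : forall t,
     {within @stochastic R t.+1 d, continuous (phi t)})
  (zeta_feedback : forall N t w,
     zeta N t w = phi t (history (fun s => muN N s w) t))
  (zetabar_feedback : forall t, zetabar t = phi t (history mu t)) :
  forall t : nat, simplex (mu t) /\
    {ae Pr, forall w, muN N t w @[N --> \oo] --> mu t}.
Proof.
have smu t : simplex (mu t) by exact: simplex_marginal.
have dev0 t y : {ae Pr, forall w,
    N%:R^-1 * deviation P N (X N) (zeta N) t y w @[N --> \oo] --> (0 : R)}.
  (* The accuracies [1/(k+1)] are countable, so the almost sure events can be intersected; [n.+1]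
     ensures at least one load. *)
  have tail sg k : `|sg| <= 1 -> {ae Pr, forall w, \forall n \near \oo,
      ~ deviation_event P n.+1 (X n.+1) (zeta n.+1) t y sg k.+1%:R^-1 w}.
    move=> sg1; set eps : R := k.+1%:R^-1.
    have e0 : 0 < eps by rewrite invr_gt0 ltr0n.
    have e1 : eps <= 1 by rewrite invf_le1 ?ltr0n// ler1n.
    set q := expR (- (eps ^+ 2 / 8)).
    have q01 : 0 <= q < 1.
      rewrite expR_ge0 /q -[X in _ < X]expR0 ltr_expR oppr_lt0.
      by rewrite divr_gt0 ?exprn_gt0 ?ltr0n.
    (* The bound for [n.+1] loads is [q * q ^+ n], hence the factor [q]. *)
    apply: (ae_near_notin _ _ q q q01) => n.
      exact: (measurable_deviation_event P G xi _ _ _ phi).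
    rewrite -exprS.
    exact: (deviation_tail P G xi _ _ _ phi).
  have sg1 : `|1 : R| <= 1 by rewrite normr1.
  have sgN1 : `|-1 : R| <= 1 by rewrite normrN1.
  have := ae_foralln (fun k => tail _ k sgN1).
  have := ae_foralln (fun k => tail _ k sg1).
  apply: filterS2 => w tail1 tailN1.
  rewrite -cvg_shiftS; apply/cvgr0Pnorm_lt => e e0.
  have [k /= ke] := filter_ex (near_infty_natSinv_lt (PosNum e0)).
  apply: filterS2 (tail1 k) (tailN1 k) => n.
  rewrite /deviation_event /= mul1r mulN1r => /negP; rewrite -ltNge => h1.
  move=> /negP; rewrite -ltNge => h2; apply: le_lt_trans ke.
  rewrite ler_norml -mulrN1 !(ler_pdivlMl, ler_pdivrMl) ?ltr0n//.
  apply/andP; split; last exact: ltW.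
  by rewrite mulrA mulrN1 lerNl ltW.
(* All times up to [t] are kept, because the input at [t] depends on the whole history. *)
have step t : {ae Pr, forall w, forall s, (s <= t)%N ->
    muN N s w @[N --> \oo] --> mu s}.
  elim: t => [|t IH].
    move: mu0_cvg; apply: filterS => w h s; rewrite leqn0 => /eqP ->.
    by rewrite /mu marginal0.
  have devt : {ae Pr, forall w, forall y,
      N%:R^-1 * deviation P N (X N) (zeta N) t y w @[N --> \oo] --> (0 : R)}.
    by apply: filter_forall => y; exact: dev0.
  apply: filterS2 IH devt => w cvgw devw s.
  rewrite leq_eqVlt => /orP[/eqP ->|]; last by rewrite ltnS; exact: cvgw.
  have zeta_cvg : zeta N t w @[N --> \oo] --> zetabar t.
    rewrite zetabar_feedback; under eq_fun do rewrite zeta_feedback.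
    apply: (within_continuous_cvg _ _ _ _ _ _ (phi_continuous t)).
    - exact: stochastic_history.
    (* With no loads the empirical vector is 0, outside the simplex, so the range starts at 1. *)
    - exists 1%N => // N /= N0; apply: stochastic_history => r.
      exact: simplex_empirical.
    - apply: cvg_mx_entries => r x; rewrite mxE; under eq_fun do rewrite mxE.
      by apply: cvg_coord; apply: cvgw; exact: leq_ord.
  have P_cvg : P (zeta N t w) @[N --> \oo] --> P (zetabar t).
    exact: cvg_comp zeta_cvg (P_continuous (zetabar t)).
  rewrite /mu marginalS; apply: cvg_mx_entries => i y; rewrite (ord1 i).
  have -> : (fun N => muN N t.+1 w 0 y) = (fun N =>
      (muN N t w *m P (zeta N t w)) 0 y +
      N%:R^-1 * deviation P N (X N) (zeta N) t y w).
    by apply/funext => N; exact: empirical_step.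
  rewrite -[X in _ --> X]addr0; apply: cvgD; last exact: devw.
  by apply: cvg_coord; apply: cvg_mulmx P_cvg; exact: cvgw.
move=> t; split => //.
by move: (step t); apply: filterS => w; exact.
Qed.
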